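(* Let $\mathcal{T}\in\mathbb{R}^{I\times J\times I\times J}$ be a symmetric tensor and let $\mathcal{T}=\mathcal{P}\ast_2\bar{\mathcal{D}}\ast_2\mathcal{P}^T$ be a tensor eigenvalue decomposition of $\mathcal{T}$, i.e. $\mathcal{P}\in\mathbb{R}^{I\times J\times I\times J}$ is an orthogonal tensor and $\bar{\mathcal{D}}\in\mathbb{R}^{I\times J\times I\times J}$ is a diagonal tensor with diagonal entries $\bar\sigma_{klkl}$. Suppose there exist matrices $\mathbf{A}\in\mathbb{R}^{I\times I}$ and $\mathbf{B}\in\mathbb{R}^{J\times J}$ such that $a_{ik}b_{jl}=p_{ijkl}$ for all $i,k\in\{1,\dots,I\}$, $j,l\in\{1,\dots,J\}$. Then the tensor eigenvalue decomposition is a multilinear SVD of $\mathcal{T}$ with core tensor $\bar{\mathcal{D}}$: $$\mathcal{T}=\bar{\mathcal{D}}\bullet_1\mathbf{A}\bullet_2\mathbf{B}\bullet_3\mathbf{A}\bullet_4\mathbf{B},\qquad\text{i.e.}\qquad t_{ij\hat i\hat j}=\sum_{k=1}^{I}\sum_{l=1}^{J}\bar\sigma_{klkl}\,a_{ik}b_{jl}a_{\hat ik}b_{\hat jl},$$ where moreover the matrices $\mathbf{A},\mathbf{B}$ satisfying the factorization identity can be chosen orthogonal.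
   Context: For $\mathcal{X},\mathcal{Y}\in\mathbb{R}^{I\times J\times I\times J}$: the Einstein product is $(\mathcal{X}\ast_2\mathcal{Y})_{ij\hat i\hat j}=\sum_{u=1}^{I}\sum_{v=1}^{J}x_{ijuv}y_{uv\hat i\hat j}$; the transpose is $(\mathcal{X}^T)_{ijkl}=x_{klij}$; $\mathcal{X}$ is symmetric if $\mathcal{X}=\mathcal{X}^T$; $\mathcal{X}$ is orthogonal if $\mathcal{X}^T\ast_2\mathcal{X}=\mathcal{I}$, where $\mathcal{I}$ has entries $\delta_{ik}\delta_{jl}$; $\mathcal{X}$ is diagonal if $x_{ijkl}=0$ unless $i=k$ and $j=l$. The Tucker mode-$n$ product $\bullet_n$ of a tensor with a matrix contracts the $n$-th index of the tensor with the second index of the matrix, so that $(\mathcal{S}\bullet_1\mathbf{A}\bullet_2\mathbf{B}\bullet_3\mathbf{C}\bullet_4\mathbf{G})_{ij\hat i\hat j}=\sum_{p,q,r,s}s_{pqrs}\,a_{ip}b_{jq}c_{\hat ir}g_{\hat js}$. A multilinear SVD of a fourth order tensor is an expression of it in this form with orthogonal square factor matrices and a core tensor of the same size. *)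

(* Defs.v *)
From HB Require Import structures.
From mathcomp Require Import all_boot all_order all_algebra.
From mathcomp Require Import reals.
Set Implicit Arguments.
Unset Strict Implicit.
Unset Printing Implicit Defensive.
Import Order.TTheory GRing.Theory Num.Theory.
Local Open Scope ring_scope.

(* Finite functions rather than plain curried ones, so that equality of
   tensors is equality of all entries. The entry x_{ijkl} is X (i, j, k, l). *)
Definition tensor4 (R : Type) (I J K L : nat) : Type :=
  {ffun 'I_I * 'I_J * 'I_K * 'I_L -> R}.

Definition mk_tensor4 (R : Type) (I J K L : nat)
    (f : 'I_I -> 'I_J -> 'I_K -> 'I_L -> R) : tensor4 R I J K L :=
  [ffun x => f x.1.1.1 x.1.1.2 x.1.2 x.2].

Declare Scope tensor4_scope.
Delimit Scope tensor4_scope with T4.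
Local Open Scope tensor4_scope.

Section EinsteinProduct.
Context {R : realType} {I J : nat}.
Implicit Types X Y : tensor4 R I J I J.

Definition einstein X Y : tensor4 R I J I J :=
  mk_tensor4 (fun i j i' j' =>
    \sum_(u < I) \sum_(v < J) X (i, j, u, v) * Y (u, v, i', j')).

End EinsteinProduct.

Notation "X *_2 Y" := (einstein X Y)
  (at level 40, left associativity) : tensor4_scope.

Section PairedTensors.
Context {R : realType} {I J : nat}.
Implicit Types X : tensor4 R I J I J.

Definition tens_tr X : tensor4 R I J I J :=
  mk_tensor4 (fun i j k l => X (k, l, i, j)).

Definition tens_id : tensor4 R I J I J :=
  mk_tensor4 (fun i j k l => (i == k)%:R * (j == l)%:R).

Definition tens_symmetric X : Prop := X = tens_tr X.

Definition tens_orthogonal X : Prop := tens_tr X *_2 X = tens_id.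

Definition tens_diagonal X : Prop :=
  forall i j k l, ~ (i = k /\ j = l) -> X (i, j, k, l) = 0.

Definition tensor_evd (T P D : tensor4 R I J I J) : Prop :=
  [/\ tens_orthogonal P, tens_diagonal D &
      T = P *_2 D *_2 tens_tr P].

End PairedTensors.

Section Tucker.
Context {R : realType}.

Definition mode1 (p I J K L : nat) (S : tensor4 R p J K L) (A : 'M[R]_(I, p))
  : tensor4 R I J K L :=
  mk_tensor4 (fun i j k l => \sum_(q < p) S (q, j, k, l) * A i q).

Definition mode2 (p I J K L : nat) (S : tensor4 R I p K L) (A : 'M[R]_(J, p))
  : tensor4 R I J K L :=
  mk_tensor4 (fun i j k l => \sum_(q < p) S (i, q, k, l) * A j q).

Definition mode3 (p I J K L : nat) (S : tensor4 R I J p L) (A : 'M[R]_(K, p))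
  : tensor4 R I J K L :=
  mk_tensor4 (fun i j k l => \sum_(q < p) S (i, j, q, l) * A k q).

Definition mode4 (p I J K L : nat) (S : tensor4 R I J K p) (A : 'M[R]_(L, p))
  : tensor4 R I J K L :=
  mk_tensor4 (fun i j k l => \sum_(q < p) S (i, j, k, q) * A l q).

End Tucker.

Notation "S \bullet_1 A" := (mode1 S A)
  (at level 40, left associativity) : tensor4_scope.
Notation "S \bullet_2 A" := (mode2 S A)
  (at level 40, left associativity) : tensor4_scope.
Notation "S \bullet_3 A" := (mode3 S A)
  (at level 40, left associativity) : tensor4_scope.
Notation "S \bullet_4 A" := (mode4 S A)
  (at level 40, left associativity) : tensor4_scope.

Definition mx_orthogonal (R : realType) (n : nat) (A : 'M[R]_n) : Prop := A^T *m A = 1%:M.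

Definition multilinear_svd (R : realType) (I J K L : nat)
    (T S : tensor4 R I J K L)
    (A : 'M[R]_I) (B : 'M[R]_J) (C : 'M[R]_K) (G : 'M[R]_L) : Prop :=
  [/\ mx_orthogonal A, mx_orthogonal B, mx_orthogonal C, mx_orthogonal G &
      T = S \bullet_1 A \bullet_2 B \bullet_3 C \bullet_4 G].

(* Main.v *)
Require Import Defs.
From HB Require Import structures.
From mathcomp Require Import all_boot all_order all_algebra.
From mathcomp Require Import reals ring.
Set Implicit Arguments.
Unset Strict Implicit.
Unset Printing Implicit Defensive.
Import Order.TTheory GRing.Theory Num.Theory.
Local Open Scope ring_scope.

(** With index pairs read as single indices, [P] is the Kronecker product of [A] and [B]. Since [D]
    is diagonal, the eigenvalue decomposition ([tensor_evdE]) and the Tucker product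
    ([tucker_diagonalE]) each collapse to one sum over pairs (k, l), and these sums agree for every
    pair of matrices that factors [P]. Orthogonality of [P] says that the Gram matrices of [A] and
    [B] have the identity as Kronecker product ([gram_factors]). For I, J > 0 they are therefore
    scalar, with reciprocal scalars, and rescaling yields orthogonal factors that still factor [P]
    ([orthogonal_factors]). *)

Lemma einsteinE (R : realType) (I J : nat) (X Y : tensor4 R I J I J) i j i' j' :
  (X *_2 Y)%T4 (i, j, i', j') =
  \sum_(u < I) \sum_(v < J) X (i, j, u, v) * Y (u, v, i', j').
Proof. by rewrite ffunE. Qed.

Lemma tens_trE (R : realType) (I J : nat) (X : tensor4 R I J I J) i j k l :
  tens_tr X (i, j, k, l) = X (k, l, i, j).
Proof. by rewrite ffunE. Qed.

Lemma tensor4P (R : Type) (I J K L : nat) (X Y : tensor4 R I J K L) :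
  (forall i j k l, X (i, j, k, l) = Y (i, j, k, l)) -> X = Y.
Proof. by move=> eqXY; apply/ffunP => -[[[i j] k] l]. Qed.

Lemma sumr_only1 (V : nmodType) (n : nat) (F : 'I_n -> V) (i : 'I_n) :
  (forall j, j <> i -> F j = 0) -> \sum_(j < n) F j = F i.
Proof.
by move=> F0; rewrite (bigD1 i) //= big1 ?addr0 // => j /eqP; apply: F0.
Qed.

Lemma tucker_diagonalE (R : realType) (I J : nat) (D : tensor4 R I J I J)
    (A C : 'M[R]_I) (B G : 'M[R]_J) i j i' j' :
  tens_diagonal D ->
  (D \bullet_1 A \bullet_2 B \bullet_3 C \bullet_4 G)%T4 (i, j, i', j') =
  \sum_(k < I) \sum_(l < J) D (k, l, k, l) * A i k * B j l * C i' k * G j' l.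
Proof.
(* Mode 4 is the outermost contraction, so the sum over [l] is moved outside to match it. Modes 4
   and 3 then supply [l] and [k], and diagonality collapses modes 2 and 1 to the same indices. *)
move=> diagD; rewrite ffunE exchange_big /=; apply: eq_bigr => l _.
rewrite ffunE mulr_suml; apply: eq_bigr => k _.
rewrite ffunE /= (@sumr_only1 _ _ _ l) => [|q neq_ql].
  rewrite ffunE /= (@sumr_only1 _ _ _ k) // => p neq_pk.
  by rewrite diagD ?mul0r // => -[].
rewrite ffunE /= big1 ?mul0r // => p _.
by rewrite diagD ?mul0r // => -[].
Qed.

Lemma tensor_evdE (R : realType) (I J : nat) (T P D : tensor4 R I J I J)
    i j i' j' :
  tensor_evd T P D ->
  T (i, j, i', j') =
  \sum_(k < I) \sum_(l < J) P (i, j, k, l) * D (k, l, k, l) * P (i', j', k, l).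
Proof.
case=> _ diagD ->; rewrite einsteinE.
apply: eq_bigr => k _; apply: eq_bigr => l _; rewrite tens_trE einsteinE.
rewrite (@sumr_only1 _ _ _ k) => [|u neq_uk].
  by rewrite (@sumr_only1 _ _ _ l) // => v neq_vl; rewrite diagD ?mulr0 // => -[].
by rewrite big1 // => v _; rewrite diagD ?mulr0 // => -[].
Qed.

Section KroneckerFactors.
Variables (R : realType) (I J : nat) (P : tensor4 R I J I J).
Variables (A : 'M[R]_I) (B : 'M[R]_J).
Hypothesis factP : forall i j k l, A i k * B j l = P (i, j, k, l).

Lemma factored_evdE (T D : tensor4 R I J I J) i j i' j' :
  tensor_evd T P D ->
  T (i, j, i', j') =
  \sum_(k < I) \sum_(l < J) D (k, l, k, l) * A i k * B j l * A i' k * B j' l.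
Proof.
move=> evdT; rewrite (tensor_evdE _ _ _ _ evdT).
apply: eq_bigr => k _; apply: eq_bigr => l _.
by rewrite -!factP; ring.
Qed.

Lemma factored_evd_tucker (T D : tensor4 R I J I J) :
  tensor_evd T P D ->
  T = (D \bullet_1 A \bullet_2 B \bullet_3 A \bullet_4 B)%T4.
Proof.
move=> evdT; apply: tensor4P => i j i' j'.
by rewrite (factored_evdE _ _ _ _ evdT) tucker_diagonalE //; case: evdT.
Qed.

(** This is the mixed-product rule for Kronecker products: the double sum defining an entry of
    [tens_tr P *_2 P] separates into a sum over [u] times a sum over [v]. *)
Lemma gram_factors (k k' : 'I_I) (l l' : 'I_J) :
  tens_orthogonal P ->
  (A^T *m A) k k' * (B^T *m B) l l' = (k == k')%:R * (l == l')%:R.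
Proof.
move=> orthP.
transitivity ((tens_tr P *_2 P)%T4 (k, l, k', l')); last by rewrite orthP ffunE.
rewrite einsteinE !mxE mulr_suml; apply: eq_bigr => u _.
rewrite mulr_sumr; apply: eq_bigr => v _.
by rewrite tens_trE -!factP !mxE; ring.
Qed.

(* The Gram matrices of A and B are a%:M and a^-1%:M for some a > 0, so
   rescaling A by 1 / sqrt a and B by sqrt a keeps all products A i k * B j l.
   If I = 0 or J = 0 there are no such products and identities will do. *)
Lemma orthogonal_factors :
  tens_orthogonal P ->
  exists (A' : 'M[R]_I) (B' : 'M[R]_J),
    [/\ forall i j k l, A' i k * B' j l = P (i, j, k, l),
        mx_orthogonal A' & mx_orthogonal B'].
Proof.
move=> orthP.
have orth1 n : mx_orthogonal (1%:M : 'M[R]_n).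
  by rewrite /mx_orthogonal trmx1 mul1mx.
case: (pickP (@predT 'I_I)) => [k0 _|noI]; last first.
  by exists 1%:M, 1%:M; split=> // i; have := noI i.
case: (pickP (@predT 'I_J)) => [l0 _|noJ]; last first.
  by exists 1%:M, 1%:M; split=> // i j; have := noJ j.
set a := (A^T *m A) k0 k0; set b := (B^T *m B) l0 l0.
have ab1 : a * b = 1 by rewrite gram_factors // !eqxx mulr1.
(* [a] is the squared norm of column [k0] of [A]. *)
have a_ge0 : 0 <= a.
  by rewrite /a mxE sumr_ge0 // => i _; rewrite mxE -expr2 sqr_ge0.
have a_neq0 : a != 0.
  by apply/eqP => a0; move/eqP: ab1; rewrite a0 mul0r eq_sym oner_eq0.
have a_gt0 : 0 < a by rewrite lt_def a_neq0.
pose s := Num.sqrt a.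
have s_neq0 : s != 0 by rewrite sqrtr_eq0 -ltNge.
have s2 : s * s = a by rewrite -expr2 sqr_sqrtr.
have gramA : A^T *m A = a%:M.
  apply/matrixP => k k'; rewrite [RHS]mxE -mulr_natr.
  (* Inserting 1 = a * b lets [b], the (l0, l0) Gram entry of [B], pair with the (k, k') Gram entry
     of [A]; this product is the Kronecker delta, and the factor [a] is left over. *)
  rewrite -[LHS]mulr1 -[X in _ * X = _]ab1 mulrCA.
  by rewrite gram_factors // eqxx mulr1.
have gramB : s ^+ 2 *: (B^T *m B) = 1%:M.
  apply/matrixP => l l'.
  by rewrite expr2 s2 mxE [RHS]mxE gram_factors // eqxx mul1r.
exists (s^-1 *: A), (s *: B); split.
- by move=> i j k l; rewrite !mxE -factP mulrACA mulVf ?mul1r.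
- rewrite /mx_orthogonal -scalemxAr linearZ /= -scalemxAl scalerA gramA -s2.
  by rewrite scale_scalar_mx -invfM mulVf // mulf_neq0.
- by rewrite /mx_orthogonal -scalemxAr linearZ /= -scalemxAl scalerA -expr2.
Qed.

End KroneckerFactors.

Theorem corollary3p23 (R : realType) (I J : nat) (T P D : tensor4 R I J I J)
    (A : 'M[R]_I) (B : 'M[R]_J)
    (hT : tens_symmetric T)
    (hPD : tensor_evd T P D)
    (hAB : forall (i : 'I_I) (j : 'I_J) (k : 'I_I) (l : 'I_J),
        A i k * B j l = P (i, j, k, l)) :
  [/\ T = (D \bullet_1 A \bullet_2 B \bullet_3 A \bullet_4 B)%T4,
      (forall (i : 'I_I) (j : 'I_J) (i' : 'I_I) (j' : 'I_J),
        T (i, j, i', j') =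
          \sum_(k < I) \sum_(l < J)
            D (k, l, k, l) * A i k * B j l * A i' k * B j' l) &
      exists (A' : 'M[R]_I) (B' : 'M[R]_J),
        (forall (i : 'I_I) (j : 'I_J) (k : 'I_I) (l : 'I_J),
          A' i k * B' j l = P (i, j, k, l)) /\
        multilinear_svd T D A' B' A' B'].
Proof.
split.
- exact: (factored_evd_tucker hAB hPD).
- by move=> i j i' j'; exact: (factored_evdE hAB).
- have [orthP _ _] := hPD.
  have [A' [B' [factP orthA' orthB']]] := orthogonal_factors hAB orthP.
  exists A', B'; split=> //; split=> //.
  exact: (factored_evd_tucker factP hPD).
Qed.
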